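(* Let $K$ be a field of characteristic zero, $R=K[x,y,z]$, $s\ge 3$, and let $I=(L_1^{a_1},\dots,L_s^{a_s})$, where $L_1,\dots,L_s$ are general linear forms and $a_1,\dots,a_s$ are positive integers. Set $p=\max\{j\mid \sum_{a_i\le j}(j+1-a_i)\le j\}$. Let $L$ be a general linear form. Then the homomorphism $\times L^3:[R/I]_{p-2}\to[R/I]_{p+1}$ has maximal rank (i.e. is injective or surjective).
   Context: A sum over an empty index set is zero. ''General'' means in a suitable nonempty Zariski open set. *)

(* Defs.v *)
From HB Require Import structures.
From mathcomp Require Import all_boot all_order all_algebra.
From mathcomp Require Import mpoly.
Set Implicit Arguments. Unset Strict Implicit. Unset Printing Implicit Defensive.
Import GRing.Theory.
Local Open Scope ring_scope.

Definition linform (K : fieldType) (v : 'I_3 -> K) : {mpoly K[3]} :=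
  \sum_(k < 3) v k *: 'X_k.

Definition in_ideal (K : fieldType) (s : nat) (g : 'I_s -> {mpoly K[3]})
    (f : {mpoly K[3]}) : Prop :=
  exists c : 'I_s -> {mpoly K[3]}, f = \sum_(i < s) c i * g i.

(* The map  x L^3 : [R/I]_d -> [R/I]_(d+3),  I = (g_1..g_s) homogeneous,
   is injective. Since [R/I]_d = R_d / (I ∩ R_d), injectivity means:
   f in R_d and L^3 f in I imply f in I. *)
Definition mulL3_injective (K : fieldType) (s : nat) (g : 'I_s -> {mpoly K[3]})
    (L : {mpoly K[3]}) (d : nat) : Prop :=
  forall f : {mpoly K[3]}, f \is d.-homog ->
    in_ideal g (L ^+ 3 * f) -> in_ideal g f.

Definition mulL3_surjective (K : fieldType) (s : nat) (g : 'I_s -> {mpoly K[3]})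
    (L : {mpoly K[3]}) (d : nat) : Prop :=
  forall h : {mpoly K[3]}, h \is (d + 3)%N.-homog ->
    exists f : {mpoly K[3]}, f \is d.-homog /\ in_ideal g (h - L ^+ 3 * f).

Definition mulL3_maximal_rank (K : fieldType) (s : nat) (g : 'I_s -> {mpoly K[3]})
    (L : {mpoly K[3]}) (d : nat) : Prop :=
  mulL3_injective g L d \/ mulL3_surjective g L d.

Definition pcond (s : nat) (a : 'I_s -> nat) (j : nat) : bool :=
  (\sum_(i < s | a i <= j) (j.+1 - a i) <= j)%N.

(* Coordinates of a parameter point v in K^((s+1)*3): the linear forms
   L_1..L_s (rows 0..s-1) and L (row s). *)
Definition param_form (K : fieldType) (s : nat) (v : 'I_(s.+1 * 3) -> K)
    (r : 'I_s.+1) : {mpoly K[3]} :=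
  linform (fun k => v (mxvec_index r k)).

(* Main.v *)
(** Let I be generated by the powers L_i^(a_i), put d = p + 1 and
    m_i = d + 1 - a_i (0 if negative). The map L^3 : [R/I]_(d-3) -> [R/I]_d
    has cokernel [R/(I, L^3)]_d, whose dual is, by apolarity, the space of
    plane curves of degree d with a point of multiplicity d - 2 (from L^3) and
    points of multiplicity m_i. Taking L = z and L_i = x + x_i y + t_i z, such
    a curve is G = A(X) T^2 + B(X) T + C(X) with multiplicity m_i at
    (x_i, t_i). Placing the points on the lines T = 0, 1, 2 and adding further
    simple points, G is forced to vanish by counting roots on the three lines;
    this uses the inequality sum (m_i - 1) <= d - 1 that defines p. Hence for a
    general choice the cokernel has dimension at most max(0, q), where
    q = 3d - 3 sum_(m_i > 0) (m_i - 1) - #{i | m_i = 1}.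
    If q <= 0 the map is surjective. Otherwise the same inequality makes the
    conditions imposed by I in degree d - 3 independent, so q is at most
    dim [R/I]_d - dim [R/I]_(d-3) and the map is injective. All bounds
    are lower bounds for ranks of matrices depending polynomially on the
    forms, so they hold on a nonempty open set once they hold at a point. *)
Require Import Defs.
From HB Require Import structures.
From mathcomp Require Import all_boot all_order all_algebra.
From mathcomp Require Import mpoly.
From mathcomp Require Import zify ring.
Set Implicit Arguments. Unset Strict Implicit. Unset Printing Implicit Defensive.
Import GRing.Theory.
Local Open Scope ring_scope.

(** * Homogeneous parts of ideals as row spaces *)

Definition o0 : 'I_3 := @Ordinal 3 0 isT.
Definition o1 : 'I_3 := @Ordinal 3 1 isT.
Definition o2 : 'I_3 := @Ordinal 3 2 isT.

(* [tri n] indexes the monomials of degree [n - 1] in three variables: the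
   tag is the exponent of z, the tagged value the exponent of y. The shift
   by one makes [tri (d.+1 - a)] empty when [a > d]. *)
Definition tri (n : nat) := {c : 'I_n & 'I_(n - c)}.

Definition mon3 (a b c : nat) : 'X_{1..3} :=
  (U_(o0) *+ a + U_(o1) *+ b + U_(o2) *+ c)%MM.

Definition tmon n (u : tri n) : 'X_{1..3} :=
  mon3 (n.-1 - tag u - tagged u) (tagged u) (tag u).

Lemma ord3P (i : 'I_3) : [\/ i = o0, i = o1 | i = o2].
Proof.
by case: i => [[|[|[|]]] lti] //; [apply: Or31|apply: Or32|apply: Or33]; exact: val_inj.
Qed.

Lemma mon3E a b c : (mon3 a b c o0 = a) * (mon3 a b c o1 = b) * (mon3 a b c o2 = c).
Proof.
by rewrite /mon3 !mnmDE !mulmnE !mnm1E /= !(mul0n, mul1n) !(addn0, add0n).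
Qed.

Lemma mon3_id (m : 'X_{1..3}) : m = mon3 (m o0) (m o1) (m o2).
Proof. by apply/mnmP => i; case: (ord3P i) => ->; rewrite mon3E. Qed.

Lemma mdeg3 (m : 'X_{1..3}) : mdeg m = (m o0 + m o1 + m o2)%N.
Proof.
rewrite [m in LHS]mon3_id /mon3 !mdegD !mdegMn !mdeg1; lia.
Qed.

Lemma card_tri n : #|{: tri n}| = 'C(n.+1, 2).
Proof.
rewrite card_tagged sumnE big_map big_enum /=.
rewrite (eq_bigr (fun c : 'I_n => (n - c)%N)) => [|c _]; last by rewrite card_ord.
elim: n => [|n IHn]; first by rewrite big_ord0 bin_small.
rewrite big_ord_recl (eq_bigr (fun i : 'I_n => (n - i)%N)) // IHn.
by rewrite subn0 [RHS]binS bin1 addnC.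
Qed.

Lemma mdeg_tmon n (u : tri n) : (mdeg (tmon u)).+1 = n.
Proof.
case: u => [[c ltc] [b ltb]]; rewrite mdeg3 /tmon !mon3E /=.
by move: ltc ltb => /=; lia.
Qed.

Lemma tmon_inj n : injective (@tmon n).
Proof.
move=> [[c ltc] [b ltb]] [[c' ltc'] [b' ltb']] /mnmP eq_m.
have /= := eq_m o2; rewrite !mon3E /= => eqc; move: eq_m.
case: _ / eqc in ltc' ltb' *; rewrite (bool_irrelevance ltc' ltc) => eq_m.
have /= := eq_m o1; rewrite !mon3E /= => eqb.
case: _ / eqb in ltb' eq_m *; by rewrite (bool_irrelevance ltb' ltb).
Qed.

Lemma tmon_surj n (m : 'X_{1..3}) : (mdeg m).+1 = n -> exists u : tri n, m = tmon u.
Proof.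
move=> dm; move: (dm); rewrite mdeg3 => dm'.
have ltc : (m o2 < n)%N by lia.
have ltb : (m o1 < n - Ordinal ltc)%N by rewrite /=; lia.
exists (Tagged (fun c : 'I_n => 'I_(n - c)) (Ordinal ltb)).
rewrite [LHS]mon3_id /tmon /=; congr mon3; lia.
Qed.

Section Coordinates.
Variable R : comNzRingType.

Definition lform (v : 'I_3 -> R) : {mpoly R[3]} := \sum_(k < 3) v k *: 'X_k.

Definition crd n (f : {mpoly R[3]}) : 'rV[R]_#|{: tri n}| :=
  \row_j f@_(tmon (enum_val j)).

Lemma crd_is_linear n : linear (crd n).
Proof. by move=> c f g; apply/rowP => j; rewrite !mxE mcoeffD mcoeffZ. Qed.

HB.instance Definition _ n :=
  GRing.isLinear.Build R {mpoly R[3]} 'rV[R]_#|{: tri n}| _ (crd n)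
    (crd_is_linear n).

Lemma crd_homog_neq n d f : f \is d.-homog -> d.+1 != n -> crd n f = 0.
Proof.
move=> hf neq; apply/rowP => j; rewrite !mxE; apply: (dhomog_nemf_coeff hf).
by apply: contra neq => /eqP <-; rewrite mdeg_tmon.
Qed.

Lemma crd_inj n f : f \is n.-homog -> crd n.+1 f = 0 -> f = 0.
Proof.
move=> hf f0; apply/mpolyP => m; rewrite mcoeff0.
case: (eqVneq (mdeg m) n) => [dm | ndm]; last exact: dhomog_nemf_coeff hf ndm.
have [u ->] := tmon_surj (congr1 S dm).
by have /rowP/(_ (enum_rank u)) := f0; rewrite !mxE enum_rankK.
Qed.

Section Span.
Variables (I : finType) (a : I -> nat) (g : I -> {mpoly R[3]}) (n : nat).

Definition rowidx := {i : I & tri (n - a i)}.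

(* The rows span the part of degree [n - 1] of the ideal generated by the
   [g i], where [g i] is homogeneous of degree [a i]. *)
Definition spanmx : 'M[R]_(#|{: rowidx}|, #|{: tri n}|) :=
  \matrix_(r, j) (let: existT i u := enum_val r in
                  'X_[tmon u] * g i)@_(tmon (enum_val j)).

Lemma row_spanmx (r : rowidx) :
  row (enum_rank r) spanmx = crd n ('X_[tmon (tagged r)] * g (tag r)).
Proof. by apply/rowP => j; rewrite !mxE enum_rankK; case: r. Qed.

Lemma card_rowidx : #|{: rowidx}| = (\sum_i 'C((n - a i).+1, 2))%N.
Proof.
rewrite card_tagged sumnE big_map big_enum /=.
by apply: eq_bigr => i _; rewrite card_tri.
Qed.

End Span.
End Coordinates.

Lemma map_spanmx (R S : comNzRingType) (phi : {rmorphism R -> S}) (I : finType)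
    (a : I -> nat) (g : I -> {mpoly R[3]}) n :
  map_mx phi (spanmx a g n) = spanmx a (fun i => map_mpoly phi (g i)) n.
Proof.
apply/matrixP => r j; rewrite !mxE; case: (enum_val r) => i u /=.
by rewrite -mcoeff_map_mpoly rmorphM /= map_mpolyX.
Qed.

Lemma map_lform (R S : comNzRingType) (phi : {rmorphism R -> S}) (v : 'I_3 -> R) :
  map_mpoly phi (lform v) = lform (fun k => phi (v k)).
Proof.
rewrite /lform raddf_sum /=; apply: eq_bigr => k _.
by rewrite map_mpolyZ map_mpolyX.
Qed.

Lemma lform_homog (R : comNzRingType) (v : 'I_3 -> R) e :
  lform v ^+ e \is e.-homog.
Proof.
have h1 : lform v \is (1%N).-homog.
  by apply: rpred_sum => k _; apply: rpredZ; rewrite dhomogX /= mdeg1.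
by have := dhomogMn e h1; rewrite mul1n.
Qed.

Section Ideal.
Variables (K : fieldType) (I : finType) (a : I -> nat) (g : I -> {mpoly K[3]}).
Hypothesis hg : forall i, g i \is (a i).-homog.

Lemma crd_mul_sub n i (h : {mpoly K[3]}) : (crd n (h * g i) <= spanmx a g n)%MS.
Proof.
rewrite [h]mpolyE mulr_suml linear_sum /=; apply: summx_sub => m _.
rewrite -scalerAl linearZ /=; apply: scalemx_sub.
case: (eqVneq (mdeg m + a i).+1 n) => [eqn | neqn]; last first.
  rewrite (crd_homog_neq (d := mdeg m + a i)) ?sub0mx //.
  by apply: dhomogM => //; rewrite dhomogX.
have [u ->] : exists u : tri (n - a i), m = tmon u by apply: tmon_surj; lia.
rewrite -(row_spanmx g (Tagged (fun i => tri (n - a i)) u)).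
exact: row_sub.
Qed.

Lemma crd_sub_span n (c : I -> {mpoly K[3]}) :
  (crd n (\sum_i c i * g i)%R <= spanmx a g n)%MS.
Proof. by rewrite linear_sum; apply: summx_sub => i _; apply: crd_mul_sub. Qed.

(** Converse of [crd_sub_span]. The cofactors are read off from the row combination, hence
    homogeneous; this later makes the cofactor of [L ^+ 3] a preimage of the right degree. *)
Lemma span_crd n f : f \is n.-homog -> (crd n.+1 f <= spanmx a g n.+1)%MS ->
  exists c : I -> {mpoly K[3]},
    (forall i, c i \is (n - a i).-homog) /\ f = \sum_i c i * g i.
Proof.
move=> hf /submxP [D eqf].
pose c i := \sum_(u : tri (n.+1 - a i))
  D 0 (enum_rank (Tagged (fun i => tri (n.+1 - a i)) u)) *: 'X_[K, tmon u].
have hc i : c i \is (n - a i).-homog.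
  apply: rpred_sum => u _; apply: rpredZ; rewrite dhomogX /=.
  by apply/eqP; have := mdeg_tmon u; lia.
exists c; split => //; apply/eqP; rewrite -subr_eq0; apply/eqP.
have hcg i : c i * g i \is n.-homog.
  case: (leqP (a i) n) => [le_an | lt_na].
    by rewrite -(subnK le_an); apply: dhomogM.
  (* Here [tri (n.+1 - a i)] is empty, so [c i] is an empty sum. *)
  rewrite /c big1 ?mul0r ?dhomog0 // => u _.
  by have := mdeg_tmon u; lia.
apply: (@crd_inj _ n); first by apply: rpredB => //; apply: rpred_sum => i _; apply: hcg.
rewrite linearB /= eqf linear_sum /=; apply/eqP; rewrite subr_eq0; apply/eqP.
transitivity (\sum_(r : rowidx a n.+1)
    D 0 (enum_rank r) *: crd n.+1 ('X_[tmon (tagged r)] * g (tag r))).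
  rewrite mulmx_sum_row (reindex (@enum_rank (rowidx a n.+1))) /=; last first.
    by apply: onW_bij; apply: enum_rank_bij.
  by apply: eq_bigr => r _; rewrite row_spanmx.
apply/esym; under eq_bigr => i _ do rewrite /c mulr_suml linear_sum /=.
rewrite sig_big_dep /=; apply: eq_bigr => -[i u] _ /=.
by rewrite -scalerAl linearZ.
Qed.

End Ideal.

(** * Ranks *)

Lemma mxrank_mxsub (K : fieldType) m n m' n' (f : 'I_m' -> 'I_m) (h : 'I_n' -> 'I_n)
    (A : 'M[K]_(m, n)) : (\rank (mxsub f h A) <= \rank A)%N.
Proof.
rewrite mxsubrc (leq_trans (mxrankS (rowsub_sub _ _))) //.
rewrite -mxrank_tr trmx_mxsub (leq_trans (mxrankS (rowsub_sub _ _))) //.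
by rewrite mxrank_tr.
Qed.

Lemma full_rank_minor (K : fieldType) m n (A : 'M[K]_(m, n)) :
  exists (f : 'I_(\rank A) -> 'I_m) (h : 'I_(\rank A) -> 'I_n),
    \det (mxsub f h A) != 0.
Proof.
pose B := (rowsub (maxrankfun A) A)^T.
have fB : row_full B by rewrite /row_full mxrank_tr eq_maxrowsub.
exists (maxrankfun A), (fullrankfun fB).
have := fullrowsub_unit fB; rewrite unitmxE unitfE -det_tr trmx_mxsub trmxK.
by rewrite -mxsubcr.
Qed.

(** [F] is a minor of maximal size at [v0]; wherever it is nonzero the rank cannot be smaller. *)
Lemma generic_rank (K : fieldType) N m n (M : 'M[{mpoly K[N]}]_(m, n)) v0 :
  exists F : {mpoly K[N]}, F.@[v0] != 0 /\
    forall v, F.@[v] != 0 ->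
      (\rank (map_mx (meval v0) M) <= \rank (map_mx (meval v) M))%N.
Proof.
have [f [h det0]] := full_rank_minor (map_mx (meval v0) M).
exists (\det (mxsub f h M)); rewrite -det_map_mx map_mxsub; split=> // v.
rewrite -det_map_mx map_mxsub => detv.
have {1}<- := mxrank_unit (A := mxsub f h (map_mx (meval v) M)).
  exact: mxrank_mxsub.
by rewrite unitmxE unitfE.
Qed.

(** [M v] specialises a matrix over the polynomial ring in the parameters; [rho i] selects the form
    of which generator [i] is a power. *)
Lemma generic_span_rank (K : fieldType) s (I : finType) (a : I -> nat)
    (rho : I -> 'I_s.+1) n (v0 : 'I_(s.+1 * 3) -> K) :
  let M v := spanmx a (fun i => param_form v (rho i) ^+ a i) n in
  exists F : {mpoly K[s.+1 * 3]}, F.@[v0] != 0 /\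
    forall v, F.@[v] != 0 -> (\rank (M v0) <= \rank (M v))%N.
Proof.
move=> M.
pose G i := lform (fun k => 'X_(mxvec_index (rho i) k) : {mpoly K[s.+1 * 3]}).
have MG v : M v = map_mx (meval v) (spanmx a (fun i => G i ^+ a i) n).
  rewrite map_spanmx; apply/matrixP => r j; rewrite !mxE.
  case: (enum_val r) => i u; congr ((_ * _)@_ _).
  rewrite rmorphXn /= map_lform; congr (_ ^+ _).
  by rewrite /param_form /linform /lform; apply: eq_bigr => k _; rewrite /= mevalXU.
by setoid_rewrite MG; apply: generic_rank.
Qed.

Lemma homog_tmonE (R : comNzRingType) n (f : {mpoly R[3]}) : f \is n.-homog ->
  f = \sum_(u : tri n.+1) f@_(tmon u) *: 'X_[tmon u].
Proof.
move=> hf; apply/mpolyP => m; rewrite raddf_sum /=.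
under eq_bigr => u _ do rewrite mcoeffZ mcoeffX.
case: (eqVneq (mdeg m) n) => [dm | ndm]; last first.
  rewrite (dhomog_nemf_coeff hf ndm) big1 // => u _.
  case: eqP => [eqm | _]; last by rewrite mulr0.
  by have := mdeg_tmon u; rewrite eqm => -[/eqP]; rewrite (negPf ndm).
have [u ->] := tmon_surj (congr1 S dm).
rewrite (bigD1 u) //= eqxx mulr1 big1 ?addr0 // => w neq_wu.
by rewrite (inj_eq (@tmon_inj _)) (negPf neq_wu) mulr0.
Qed.

(** * From ranks of span matrices to injectivity and surjectivity *)

Lemma big_option (V : nmodType) (I : finType) (F : option I -> V) :
  \sum_i F i = F None + \sum_i F (Some i).
Proof.
by rewrite ![index_enum _]unlock [@Finite.enum in LHS]unlock /= big_cons big_map.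
Qed.

(** [None] indexes the added generator [L ^+ 3]; the same device extends degrees, generators and
    parameter rows. *)
Definition with_cube (T : Type) I (x : I -> T) (y : T) (i : option I) : T :=
  if i is Some j then x j else y.

Section MaximalRank.
Variables (K : fieldType) (s : nat) (a : 'I_s -> nat) (g : 'I_s -> {mpoly K[3]}).
Variables (L : {mpoly K[3]}) (d : nat).
Hypothesis hg : forall i, g i \is (a i).-homog.
Hypothesis hL : L ^+ 3 \is 3.-homog.

Let a' := with_cube a 3.
Let g' := with_cube g (L ^+ 3).

Let hg' i : g' i \is (a' i).-homog.
Proof. by case: i. Qed.

Lemma mulL3_surjective_of_rank :
  (#|{: tri d.+4}| <= \rank (spanmx a' g' d.+4))%N ->
  mulL3_surjective g L d.
Proof.
rewrite col_leq_rank => full h; rewrite addn3 => hh.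
have [c [hc ->]] := span_crd hg' hh (submx_full _ full).
exists (c None); split; first by have := hc None; rewrite /= !subSS subn0.
exists (fun i => c (Some i)); rewrite big_option /= [c None * _]mulrC.
by rewrite addrC addrK.
Qed.

(** Rank-nullity for [Q], multiplication by [L ^+ 3] into forms of degree [d + 3] modulo the ideal.
    Its rank is at least [\rank M3 - \rank M2 >= q1], so its kernel has dimension at most
    [\rank M1]; as it contains the row space of [M1], the two coincide. *)
Lemma mulL3_injective_of_rank q q1 :
  (#|{: tri d.+1}| <= \rank (spanmx a g d.+1) + q1)%N ->
  (#|{: tri d.+4}| <= \rank (spanmx a' g' d.+4) + q)%N ->
  (#|{: rowidx a d.+4}| + q + q1 <= #|{: tri d.+4}|)%N ->
  mulL3_injective g L d.
Proof.
set M1 := spanmx a g d.+1; set M2 := spanmx a g d.+4.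
set M3 := spanmx a' g' d.+4 => rk1 rk3 card_le f hf [c eqf].
pose P : 'M_(#|{: tri d.+1}|, _) :=
  \matrix_j crd d.+4 ('X_[K, tmon (enum_val j)] * L ^+ 3).
have crdP h : h \is d.-homog -> crd d.+4 (h * L ^+ 3) = crd d.+1 h *m P.
  move=> hh; rewrite {1}(homog_tmonE hh) mulr_suml linear_sum mulmx_sum_row /=.
  rewrite [RHS](reindex (@enum_rank (tri d.+1))) /=; last first.
    by apply: onW_bij; apply: enum_rank_bij.
  by apply: eq_bigr => u _; rewrite -scalerAl linearZ rowK mxE enum_rankK.
have M3_sub : (M3 <= P + M2)%MS.
  apply/row_subP => r; rewrite -(enum_valK r) row_spanmx.
  case: (enum_val r) => -[i | /=] u /=.
    by apply: submx_trans (crd_mul_sub hg _ _ _) (addsmxSr _ _).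
  rewrite crdP ?(submx_trans (submxMl _ _) (addsmxSl _ _)) //.
  by rewrite dhomogX /=; apply/eqP; have := mdeg_tmon u; rewrite /=; lia.
pose Q := P *m cokermx M2.
have rkQ : (#|{: tri d.+1}| <= \rank M1 + \rank Q)%N.
  have := mxrank_mul_ker (P + M2)%MS (cokermx M2).
  rewrite addsmxMr mulmx_coker addsmx0 -/Q.
  have := mxrankS M3_sub.
  have := mxrankS (capmxSr (P + M2)%MS (kermx (cokermx M2))).
  rewrite mxrank_ker mxrank_coker -/Q.
  have := rank_leq_row M2; have := rank_leq_col M2.
  lia.
have M1_ker : (M1 <= kermx Q)%MS.
  apply/row_subP => r; rewrite -(enum_valK r) row_spanmx.
  case: (enum_val r) => i u /=; apply/sub_kermxP.
  rewrite mulmxA -crdP; last first.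
    have du := mdeg_tmon u; have le_ad : (a i <= d)%N by lia.
    rewrite -[X in X.-homog](subnK le_ad) dhomogM // dhomogX /=.
    by apply/eqP; lia.
  by apply/eqP; rewrite -submxE mulrAC; apply: crd_mul_sub.
have ker_M1 : (kermx Q <= M1)%MS.
  rewrite -(geq_leqif (mxrank_leqif_sup M1_ker)) mxrank_ker.
  by have := rank_leq_row Q; lia.
have f_M1 : (crd d.+1 f <= M1)%MS.
  apply: submx_trans ker_M1; apply/sub_kermxP.
  rewrite mulmxA -crdP //; apply/eqP; rewrite -submxE mulrC eqf.
  exact: crd_sub_span.
by have [c' [_ ->]] := span_crd hg hf f_M1; exists c'.
Qed.

End MaximalRank.

(** * Apolarity *)

(** The powers are pairwise coprime, so their product divides [p], and its degree is too large for a
    nonzero [p]. *)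
Lemma root_count (K : fieldType) (J : finType) (x : J -> K) (e : J -> nat)
    (p : {poly K}) : injective x ->
  (forall j, ('X - (x j)%:P) ^+ e j %| p)%R -> (size p <= \sum_j e j)%N -> p = 0.
Proof.
move=> x_inj dvd_p size_p.
have size_prod : size (\prod_j ('X - (x j)%:P) ^+ e j) = (\sum_j e j).+1.
  rewrite size_prod => [|j _]; last by rewrite expf_neq0 // polyXsubC_eq0.
  under eq_bigr => j _ do rewrite size_exp_XsubC -addn1.
  by rewrite big_split /= sum1_card; lia.
have dvd_prod : (\prod_j ('X - (x j)%:P) ^+ e j %| p)%R.
  have := index_enum_uniq J; elim: (index_enum J) => [|j r IHr] /=.
    by rewrite big_nil dvd1p.
  case/andP => j_notin_r /IHr dvd_r; rewrite big_cons Gauss_dvdp ?dvd_p ?dvd_r //.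
  rewrite big_seq; elim/big_ind: _ => [|u v cu cv|i i_r]; rewrite ?coprimep1 //.
    by rewrite coprimepMr cu.
  apply: coprimep_expl; apply: coprimep_expr; rewrite coprimep_XsubC2 // subr_eq0.
  by rewrite (inj_eq x_inj); apply: contraNneq j_notin_r => <-.
apply: contraTeq size_p => p_neq0.
by rewrite -ltnNge -size_prod dvdp_leq.
Qed.

Lemma dvdp_scale (K : fieldType) c (p q : {poly K}) : (p %| q)%R -> (p %| c *: q)%R.
Proof. by move=> dvd_pq; rewrite -mul_polyC dvdp_mull. Qed.

Section Functional.
Variables (K : fieldType) (lam : {scalar {mpoly K[3]}}).

Let X : {mpoly K[3]} := 'X_o0.
Let Y : {mpoly K[3]} := 'X_o1.
Let Z : {mpoly K[3]} := 'X_o2.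

(* The form dual to [lam], restricted to the line [f + t Y]: if [lam] kills
   the multiples of [(f + x Y) ^ a], then [t = x] is a root of multiplicity at
   least [e + 1 - a]. *)
Definition pol (f g : {mpoly K[3]}) e : {poly K} :=
  map_poly lam ((f%:P + Y%:P * 'X) ^+ e * g%:P).

Lemma map_poly_lamM (h : {mpoly K[3]}) (q : {poly K}) :
  map_poly lam (h%:P * map_poly (@mpolyC 3 K) q) = lam h *: q.
Proof.
apply/polyP => i; rewrite coef_map_id0 ?raddf0 // coefCM coefZ.
by rewrite coef_map_id0 ?mpolyC0 // mulrC mul_mpolyC linearZ /= mulrC.
Qed.

Lemma map_poly_lamZ c (p : {poly {mpoly K[3]}}) :
  map_poly lam (c%:MP *: p) = c *: map_poly lam p.
Proof.
apply/polyP => i; rewrite coef_map_id0 ?raddf0 // !coefZ coef_map_id0 ?raddf0 //.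
by rewrite mul_mpolyC linearZ.
Qed.

(** Binomial expansion of [f + t Y = (f + x Y) + (t - x) Y]. *)
Lemma pol_taylor x f g e : pol f g e = \sum_(j < e.+1)
  (lam ((f + x *: Y) ^+ (e - j) * Y ^+ j * g) *+ 'C(e, j)) *: ('X - x%:P) ^+ j.
Proof.
rewrite /pol; have -> : f%:P + Y%:P * 'X =
    (f + x *: Y)%:P + Y%:P * map_poly (@mpolyC 3 K) ('X - x%:P).
  rewrite rmorphB /= map_polyX map_polyC /= -mul_mpolyC polyCD polyCM.
  ring.
rewrite exprDn mulr_suml raddf_sum /=; apply: eq_bigr => j _.
rewrite mulrnAl raddfMn /= -scalerMnl; congr (_ *+ _).
rewrite -map_poly_lamM exprMn -!rmorphXn /= !polyCM; congr (map_poly _ _).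
by ring.
Qed.

Lemma size_pol f g e : (size (pol f g e) <= e.+1)%N.
Proof.
rewrite (pol_taylor 0); apply: leq_trans (size_sum _ _ _) _.
apply/bigmax_leqP => j _ /=.
rewrite (leq_trans (size_scale_leq _ _)) // subr0 size_polyXn.
exact: ltn_ord.
Qed.

(** A Taylor term with [a <= e - j] contains the killed power; every other term has
    [j >= e.+1 - a]. *)
Lemma pol_dvd x f g e a : (forall h, lam (h * (f + x *: Y) ^+ a) = 0) ->
  (('X - x%:P) ^+ (e.+1 - a) %| pol f g e)%R.
Proof.
move=> lam0; rewrite (pol_taylor x).
elim/big_ind: _ => [|u v du dv|j _]; rewrite ?dvdp0 ?dvdp_add //.
case: (leqP a (e - j)) => [le_a | lt_a]; last first.
  by apply: dvdp_scale; apply: dvdp_exp2l; have := ltn_ord j; lia.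
have -> : (f + x *: Y) ^+ (e - j) * Y ^+ j * g =
    ((f + x *: Y) ^+ (e - j - a) * Y ^+ j * g) * (f + x *: Y) ^+ a.
  by rewrite -[in LHS](subnK le_a) exprD; ring.
by rewrite lam0 mul0rn scale0r dvdp0.
Qed.

(** Only the constant Taylor term has to vanish: one linear condition on [lam] imposes one simple
    root. *)
Lemma pol_dvd1 x f g e : lam ((f + x *: Y) ^+ e * g) = 0 -> ('X - x%:P %| pol f g e)%R.
Proof.
move=> lam0; rewrite (pol_taylor x) big_ord_recl subn0 expr0 mulr1 lam0.
rewrite mul0rn scale0r add0r.
elim/big_ind: _ => [|u v du dv|j _]; rewrite ?dvdp0 ?dvdp_add //.
by rewrite dvdp_scale // exprS dvdp_mulr.
Qed.

Lemma pol_eq0 f g e : (forall h, lam (h * g) = 0) -> pol f g e = 0.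
Proof.
move=> lam0; rewrite (pol_taylor 0) big1 // => j _.
by rewrite lam0 mul0rn scale0r.
Qed.

Lemma pol_addZ t f g e : pol (f + t *: Z) g e =
  \sum_(0 <= j < e.+1) (t ^+ j *+ 'C(e, j)) *: pol f (g * Z ^+ j) (e - j).
Proof.
rewrite big_mkord.
have -> : pol (f + t *: Z) g e =
    map_poly lam ((f%:P + Y%:P * 'X + (t *: Z)%:P) ^+ e * g%:P).
  by congr (map_poly _ (_ ^+ _ * _)); rewrite polyCD; ring.
rewrite exprDn mulr_suml raddf_sum /=; apply: eq_bigr => j _.
rewrite mulrnAl raddfMn /= -scalerMnl; congr (_ *+ _).
rewrite -map_poly_lamZ -rmorphXn /= exprZn -!mul_mpolyC -mul_polyC !polyCM.
by congr (map_poly _ _); ring.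
Qed.

End Functional.

(** * Curves with a point of multiplicity d - 2 *)

Section ThreeLines.
Variables (K : fieldType) (d : nat) (A B C : {poly K}).
Hypothesis char0 : [pchar K] =i pred0.
Hypothesis d_gt1 : (1 < d)%N.
Variables (J : finType) (x : J -> K) (tau m : J -> nat).
Hypothesis x_inj : injective x.

Hypothesis dvdA : forall j, (('X - (x j)%:P) ^+ (m j - 2) %| A)%R.
Hypothesis dvdB : forall j,
  (('X - (x j)%:P) ^+ (m j - 1) %| B + ((tau j)%:R * d.-1%:R) *: A)%R.
Hypothesis dvdC : forall j, (('X - (x j)%:P) ^+ m j %|
  C + ((tau j)%:R * d%:R) *: B + ((tau j)%:R ^+ 2 *+ 'C(d, 2)) *: A)%R.

Hypothesis sizeA : (size A <= d.-1)%N.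
Hypothesis sizeB : (size B <= d)%N.
Hypothesis sizeC : (size C <= d.+1)%N.

Hypothesis tau_le2 : forall j, (tau j <= 2)%N.
Hypothesis count0 : (d < \sum_j (if tau j == 0 then m j else m j - 2))%N.
Hypothesis count1 : (d <= \sum_j (if tau j == 1 then m j else m j - 2))%N.
Hypothesis count2 : (d.-1 <= \sum_j (if tau j == 2 then m j else m j - 1))%N.

(* [G = C + d t B + 'C(d, 2) t^2 A] has a point of multiplicity [m j] at
   [(x j, tau j)]; its restrictions to the lines [t = 0], [t = 1], [t = 2]
   have, one after the other, too many roots. *)
Lemma three_lines : [/\ A = 0, B = 0 & C = 0].
Proof.
have natr_eq0 n : (n%:R == 0 :> K) = (n == 0)%N by have /pcharf0P := char0.
have dvdB2 j : (('X - (x j)%:P) ^+ (m j - 2) %| B)%R.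
  rewrite -(dvdp_addl _ (dvdp_scale ((tau j)%:R * d.-1%:R) (dvdA j))).
  by apply: dvdp_trans (dvdB j); apply: dvdp_exp2l; lia.
have dvdC2 j : (('X - (x j)%:P) ^+ (m j - 2) %| C)%R.
  rewrite -(dvdp_addl _ (dvdp_scale ((tau j)%:R * d%:R) (dvdB2 j))).
  rewrite -(dvdp_addl _ (dvdp_scale ((tau j)%:R ^+ 2 *+ 'C(d, 2)) (dvdA j))).
  by apply: dvdp_trans (dvdC j); apply: dvdp_exp2l; lia.
(* On [t = 0] the curve is [C]; points on this line count fully, the others with [m j - 2]. *)
have C0 : C = 0.
  apply: (root_count x_inj _ (leq_trans sizeC count0)) => j.
  case: eqP => // tau0; have := dvdC j.
  by rewrite tau0 mul0r expr0n mul0rn !scale0r !addr0.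
have dvdD j : (('X - (x j)%:P) ^+ m j %|
    ((tau j)%:R * d%:R) *: B + ((tau j)%:R ^+ 2 *+ 'C(d, 2)) *: A)%R.
  by have := dvdC j; rewrite C0 add0r.
(* With [C = 0], this is [G] on the line [t = 1]; its degree bound has dropped by one. *)
have D0 : d%:R *: B + 'C(d, 2)%:R *: A = 0.
  apply: (root_count x_inj (e := fun j => (if tau j == 1 then m j else m j - 2)%N)) => [j|].
    case: eqP => [tau1 | _]; last by rewrite dvdp_add // dvdp_scale.
    by have := dvdD j; rewrite tau1 mul1r expr1n.
  apply: leq_trans (size_polyD _ _) _; rewrite geq_max.
  apply/andP; split; apply: leq_trans (size_scale_leq _ _) _; lia.
have d_neq0 : d%:R != 0 :> K by rewrite natr_eq0; lia.
have d1_neq0 : d.-1%:R != 0 :> K by rewrite natr_eq0; lia.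
have two_neq0 : 2%:R != 0 :> K by rewrite natr_eq0.
have bin_d : 'C(d, 2)%:R = d%:R * d.-1%:R / 2%:R :> K.
  apply: (mulfI two_neq0); rewrite mulrC mulrCA divff // mulr1 -!natrM.
  by rewrite mulnC -mul_bin_diag bin1.
have B_A : B = - (d.-1%:R / 2%:R) *: A.
  apply: (scalerI d_neq0); apply/eqP; rewrite -subr_eq0 -[X in _ == X]D0.
  rewrite scalerA -scaleNr; apply/eqP; congr (_ + _ *: _); rewrite bin_d.
  by field.
(* Now [G = 'C(d, 2) t (t - 1) A]. At points with [t = 2] the scalar is nonzero, which gives [m j]
   roots of [A]; at [t = 0] and [t = 1] the derivative condition [dvdB] still gives [m j - 1]. *)
have A0 : A = 0.
  apply: (root_count x_inj (e := fun j => (if tau j == 2 then m j else m j - 1)%N)) => [j|].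
    case: eqP => [tau2 | tau2].
      have := dvdD j; rewrite tau2 B_A scalerA -scalerDl -[_ *+ 'C(d, 2)]mulr_natr bin_d.
      have -> : 2%:R * d%:R * - (d.-1%:R / 2%:R) + 2%:R ^+ 2 * (d%:R * d.-1%:R / 2%:R)
          = d%:R * d.-1%:R :> K by field.
      by rewrite dvdpZr // mulf_neq0.
    have := dvdB j; rewrite B_A -scalerDl dvdpZr //.
    have [-> | ->] : tau j = 0%N \/ tau j = 1%N by have := tau_le2 j; lia.
      by rewrite mul0r addr0 oppr_eq0 mulf_neq0 ?invr_eq0.
    have -> : - (d.-1%:R / 2%:R) + 1%:R * d.-1%:R = d.-1%:R / 2%:R :> K by field.
    by rewrite mulf_neq0 ?invr_eq0.
  exact: leq_trans sizeA count2.
by rewrite B_A A0 scaler0.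
Qed.

End ThreeLines.

(** * Functionals that kill the multiples of [Z ^+ 3] and of the powers at the points *)

Section Vanishing.
Variables (K : fieldType) (lam : {scalar {mpoly K[3]}}).
Hypothesis char0 : [pchar K] =i pred0.

Let X : {mpoly K[3]} := 'X_o0.
Let Y : {mpoly K[3]} := 'X_o1.
Let Z : {mpoly K[3]} := 'X_o2.

Let natr_eq0 n : (n%:R == 0 :> K) = (n == 0)%N.
Proof. by have /pcharf0P := char0. Qed.

(** The coefficient of [t ^ b] in [pol] is a value of [lam] on a monomial times a binomial
    coefficient, which is invertible in characteristic zero. *)
Lemma lam_tmon_eq0 n : (forall c, (c < n)%N -> pol lam X (Z ^+ c) (n.-1 - c) = 0) ->
  forall u : tri n, lam 'X_[tmon u] = 0.
Proof.
move=> pol0 [[c ltc] [b ltb]]; rewrite /tmon /mon3 /=.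
have le_b : (b < (n.-1 - c).+1)%N by move: ltb => /=; lia.
have /polyP/(_ b) := pol0 c ltc; rewrite (pol_taylor _ 0) coef0 coef_sum.
rewrite (bigD1 (Ordinal le_b)) //= subr0 scale0r addr0 coefZ coefXn eqxx mulr1.
rewrite big1 ?addr0; last first.
  move=> j /eqP neq; rewrite coefZ coefXn; case: eqP; rewrite ?mulr0 //.
  by move=> eq_b; case: neq; apply: val_inj.
move/eqP; rewrite -mulr_natr mulf_eq0 natr_eq0 -leqn0 leqNgt bin_gt0 -ltnS le_b.
by rewrite orbF => /eqP; rewrite !mpolyXD !mpolyXn.
Qed.

Variables (d0 : nat).
Let d := d0.+2.

Hypothesis lamZ3 : forall h, lam (h * Z ^+ 3) = 0.

Let C := pol lam X 1 d.
Let B := pol lam X Z d.-1.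
Let A := pol lam X (Z ^+ 2) d0.

Let pol_high f j e : (2 < j)%N -> pol lam f (Z ^+ j) e = 0.
Proof.
by move=> j_gt2; apply: pol_eq0 => h; rewrite -(subnK j_gt2) exprD mulrA.
Qed.

(** This and the next two identities describe [G] and, up to the factors [d] and [d (d - 1)], its
    first two derivatives in [t]. The expansions stop because [lam] kills multiples of [Z ^+ 3]. *)
Lemma pol_add0 t :
  pol lam (X + t *: Z) 1 d = C + (t * d%:R) *: B + (t ^+ 2 *+ 'C(d, 2)) *: A.
Proof.
rewrite pol_addZ big_ltn // big_ltn // big_ltn // big_nat_cond big1; last first.
  by move=> j /andP[/andP[j_gt2 _] _]; rewrite mul1r pol_high ?scaler0.
by rewrite !mul1r bin0 bin1 subn0 subn1 subn2 mulr1n scale1r addrA mulr_natr !addrA [LHS]addr0.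
Qed.

Lemma pol_add1 t : pol lam (X + t *: Z) Z d.-1 = B + (t * d.-1%:R) *: A.
Proof.
rewrite pol_addZ big_ltn // big_ltn // big_nat_cond big1; last first.
  by move=> j /andP[/andP[j_gt1 _] _]; rewrite -exprS pol_high ?scaler0.
by rewrite bin0 bin1 subn0 subn1 mulr1 mulr1n scale1r mulr_natr !addrA [LHS]addr0.
Qed.

Lemma pol_add2 t : pol lam (X + t *: Z) (Z ^+ 2) d0 = A.
Proof.
rewrite pol_addZ big_ltn // big_nat_cond big1; last first.
  by move=> j /andP[/andP[j_gt0 _] _]; rewrite -exprD pol_high ?scaler0.
by rewrite bin0 subn0 mulr1 mulr1n scale1r [LHS]addr0.
Qed.

Variables (J : finType) (x : J -> K) (tau a : J -> nat).
Hypothesis x_inj : injective x.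
Hypothesis lam_pt : forall j h,
  lam (h * (X + x j *: Y + (tau j)%:R *: Z) ^+ a j) = 0.
Let m j := (d.+1 - a j)%N.

Let dvd_pt j c e : (c + e = d)%N ->
  (('X - (x j)%:P) ^+ (m j - c) %| pol lam (X + (tau j)%:R *: Z) (Z ^+ c) e)%R.
Proof.
move=> ce; have -> : (m j - c = e.+1 - a j)%N by rewrite /m; lia.
by apply: pol_dvd => h; rewrite addrAC lam_pt.
Qed.

Hypothesis tau_le2 : forall j, (tau j <= 2)%N.
Hypothesis count0 : (d < \sum_j (if tau j == 0 then m j else m j - 2))%N.
Hypothesis count1 : (d <= \sum_j (if tau j == 1 then m j else m j - 2))%N.
Hypothesis count2 : (d.-1 <= \sum_j (if tau j == 2 then m j else m j - 1))%N.

Lemma pol_vanish c : (c <= d)%N -> pol lam X (Z ^+ c) (d - c) = 0.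
Proof.
have [j|j|j||||A0 B0 C0] := three_lines (d := d) (A := A) (B := B) (C := C) (m := m)
    char0 isT x_inj _ _ _ _ _ _ tau_le2 count0 count1 count2.
- by rewrite -(pol_add2 (tau j)%:R) dvd_pt.
- by rewrite -pol_add1; apply: (@dvd_pt _ 1).
- by rewrite -pol_add0 -[m j]subn0; apply: (@dvd_pt _ 0).
- exact: size_pol.
- exact: size_pol.
- exact: size_pol.
case: c => [|[|[|c]]] _.
- by rewrite subn0 expr0; exact: C0.
- by rewrite subn1 expr1; exact: B0.
- by rewrite subn2; exact: A0.
- exact: pol_high.
Qed.

End Vanishing.

(** * Distributing the points over three lines *)

Lemma pcard_sum (J : finType) (S : {set J}) : (\sum_j (j \in S) = #|S|)%N.
Proof. by rewrite -sum1_card [RHS]big_mkcond; apply: eq_bigr => j _; case: (j \in S). Qed.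

Lemma subset_of_card (J : finType) (S : {set J}) k : (k <= #|S|)%N ->
  exists2 T : {set J}, T \subset S & #|T| = k.
Proof.
move=> le_k; have : (0 < #|[set T : {set J} | T \subset S & #|T| == k]|)%N.
  by rewrite cards_draws bin_gt0.
by case/card_gt0P => T; rewrite inE => /andP[sTS /eqP cT]; exists T.
Qed.

(* The double points are spread evenly over the lines t = 0 and t = 1, the
   simple points fill up the three counts. *)
Lemma spread_points (J : finType) (m : J -> nat) d : (0 < d)%N ->
  (\sum_j (m j - 1) <= d.-1)%N ->
  (3 * d <= 3 * (\sum_j (m j - 1)) + #|[set j | m j == 1]|)%N ->
  exists tau : J -> nat,
    [/\ forall j, (tau j <= 2)%N,
        (d < \sum_j (if tau j == 0 then m j else m j - 2))%N,
        (d <= \sum_j (if tau j == 1 then m j else m j - 2))%N &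
        (d.-1 <= \sum_j (if tau j == 2 then m j else m j - 1))%N].
Proof.
move=> d_gt0 le1 le2.
pose D := [set j | (1 < m j)%N]; pose S := [set j | m j == 1%N].
pose E := (\sum_j (m j - 2))%N.
have sum1 : (\sum_j (m j - 1) = E + #|D|)%N.
  by rewrite -pcard_sum -big_split /=; apply: eq_bigr => j _; rewrite inE; lia.
have [D0 sD0 cD0] : exists2 D0 : {set J}, D0 \subset D & #|D0| = (#|D| %/ 2)%N.
  by apply: subset_of_card; lia.
have cD1 : #|D :\: D0| = (#|D| - #|D| %/ 2)%N.
  by rewrite cardsD (setIidPr sD0) cD0.
(* [T0] and [T1] fill exactly what the first two counts lack. By [le1], [E + #|D| < d], so no
   subtraction truncates, and the three deficits add up to [3 d - 3 E - 3 #|D|], which [le2] bounds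
   by [#|S|]. *)
have [T0 sT0 cT0] : exists2 T0 : {set J}, T0 \subset S &
    #|T0| = (d - E + 1 - 2 * (#|D| %/ 2))%N.
  by apply: subset_of_card; rewrite -/S in le2; lia.
have cS1 : #|S :\: T0| = (#|S| - #|T0|)%N by rewrite cardsD (setIidPr sT0).
have [T1 sT1 cT1] : exists2 T1 : {set J}, T1 \subset S :\: T0 &
    #|T1| = (d - E - 2 * (#|D| - #|D| %/ 2))%N.
  by apply: subset_of_card; rewrite -/S in le2; lia.
have cS2 : #|(S :\: T0) :\: T1| = (#|S :\: T0| - #|T1|)%N.
  by rewrite cardsD (setIidPr sT1).
have mD j : (j \in D) = (1 < m j)%N by rewrite inE.
have mS j : (j \in S) = (m j == 1%N) by rewrite inE.
pose tau j := (if (j \in D0) || (j \in T0) then 0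
               else if (j \in D) || (j \in T1) then 1 else 2)%N.
have inS j : ((j \in D0) <= (j \in D))%N /\ ((j \in T0) <= (j \in S))%N /\
             ((j \in T1) <= (j \in S) - (j \in T0))%N.
  do !split.
  - by have /implyP := subsetP sD0 j; do 2!case: (_ \in _).
  - by have /implyP := subsetP sT0 j; do 2!case: (_ \in _).
  - by have /implyP := subsetP sT1 j; rewrite in_setD; do 3!case: (_ \in _).
exists tau; split.
- by move=> j; rewrite /tau; do 2?case: ifP.
- have : (\sum_j ((m j - 2) + ((j \in D0) + (j \in D0)) + (j \in T0)) <=
          \sum_j (if tau j == 0 then m j else m j - 2))%N.
    apply: leq_sum => j _; have := inS j; rewrite mS /tau !mD.
    case: (j \in D0); case: (j \in T0); case: (j \in T1);
      case: (m j) => [|[|k]] /=; clear; lia.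
  rewrite !big_split /= !pcard_sum.
  rewrite -/S in le2; rewrite -/E cD0 cT0; lia.
- have : (\sum_j ((m j - 2) + ((j \in D :\: D0) + (j \in D :\: D0)) + (j \in T1)) <=
          \sum_j (if tau j == 1 then m j else m j - 2))%N.
    apply: leq_sum => j _; have := inS j; rewrite in_setD mS /tau !mD.
    case: (j \in D0); case: (j \in T0); case: (j \in T1);
      case: (m j) => [|[|k]] /=; clear; lia.
  rewrite !big_split /= !pcard_sum.
  rewrite -/S in le2; rewrite -/E cD1 cT1; lia.
- have : (\sum_j ((m j - 1) + (j \in (S :\: T0) :\: T1)) <=
          \sum_j (if tau j == 2 then m j else m j - 1))%N.
    apply: leq_sum => j _; have := inS j; rewrite !in_setD mS /tau !mD.
    case: (j \in D0); case: (j \in T0); case: (j \in T1);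
      case: (m j) => [|[|k]] /=; clear; lia.
  rewrite !big_split /= !pcard_sum.
  rewrite -/S in le2; rewrite sum1 cS2 cS1 cT0 cT1; lia.
Qed.

(** * Special positions *)

(** Stacking [Q] under [M] gives full column rank, and [q] rows contribute at most [q]. The rows of
    [Q] will be auxiliary vanishing conditions. *)
Lemma rank_of_kernel (K : fieldType) m q n (M : 'M[K]_(m, n)) (Q : 'M[K]_(q, n)) :
  (forall w : 'cV_n, M *m w = 0 -> Q *m w = 0 -> w = 0) -> (n <= \rank M + q)%N.
Proof.
move=> ker0; suff free : row_free (col_mx M Q)^T.
  have := eqP free; rewrite mxrank_tr -addsmxE => {1}<-.
  by rewrite (leq_trans (mxrank_adds_leqif _ _)) // leq_add2l rank_leq_row.
apply: inj_row_free => v /(congr1 trmx).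
rewrite trmx_mul trmxK trmx0 mul_col_mx -col_mx0 => /eq_col_mx[Mv Qv].
by apply: trmx_inj; rewrite trmx0; exact: ker0.
Qed.

Section CoordinateFunctional.
Variables (K : fieldType) (n : nat) (w : 'cV[K]_#|{: tri n}|).

(** The vector [w] as a functional on all polynomials, zero outside degree [n - 1]; annihilation of
    multiples [h * g i] then needs no degree condition on [h]. *)
Definition crd_fun (f : {mpoly K[3]}) : K := (crd n f *m w) 0 0.

Lemma crd_fun_is_linear : scalar crd_fun.
Proof. by move=> c f g; rewrite /crd_fun linearP mulmxDl -scalemxAl !mxE. Qed.

HB.instance Definition _ :=
  GRing.isLinear.Build K {mpoly K[3]} K *%R crd_fun crd_fun_is_linear.

Lemma crd_fun_eq0 : (forall u : tri n, crd_fun 'X_[tmon u] = 0) -> w = 0.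
Proof.
move=> w0; apply/colP => j; rewrite mxE -(w0 (enum_val j)) /crd_fun mxE.
rewrite (bigD1 j) //= mxE mcoeffX eqxx mul1r big1 ?addr0 // => i neq_ij.
rewrite mxE mcoeffX (inj_eq (@tmon_inj n)) (inj_eq enum_val_inj) eq_sym.
by rewrite (negPf neq_ij) mul0r.
Qed.

Lemma crd_fun_span (I : finType) (a : I -> nat) (g : I -> {mpoly K[3]}) :
  (forall i, g i \is (a i).-homog) -> spanmx a g n *m w = 0 ->
  forall i h, crd_fun (h * g i) = 0.
Proof.
move=> hg Mw i h; rewrite /crd_fun; have /submxP[D ->] := crd_mul_sub hg n i h.
by rewrite -mulmxA Mw mulmx0 mxE.
Qed.

End CoordinateFunctional.

Definition vec3 (K : Type) (u v w : K) (k : 'I_3) : K := nth u [:: u; v; w] k.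

Lemma linform_vec3 (K : fieldType) (u v w : K) :
  linform (vec3 u v w) = u *: 'X_o0 + v *: 'X_o1 + w *: 'X_o2.
Proof.
rewrite /linform !big_ord_recl big_ord0 addr0 addrA.
by congr (_ *: 'X__ + _ *: 'X__ + _ *: 'X__); apply: val_inj.
Qed.

Lemma param_form_surj (K : fieldType) s (c : 'I_s.+1 -> 'I_3 -> K) :
  exists v, forall r, param_form v r = linform (c r).
Proof.
exists (fun k => mxvec (\matrix_(r, k) c r k) 0 k) => r.
by rewrite /param_form /linform; apply: eq_bigr => k _; rewrite mxvecE mxE.
Qed.

Lemma param_form_homog (K : fieldType) s (v : 'I_(s.+1 * 3) -> K) r e :
  param_form v r ^+ e \is e.-homog.
Proof. exact: lform_homog. Qed.

Section SpecialPosition.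
Variables (K : fieldType) (s : nat) (a : 'I_s -> nat).
Hypothesis char0 : [pchar K] =i pred0.

Let natr_inj : injective (fun n => n%:R : K).
Proof.
have /pcharf0P natr_eq0 := char0.
move=> i j; wlog le_ij : i j / (i <= j)%N => [IH|/eqP].
  by case/orP: (leq_total i j) => /IH // eqij /esym /eqij.
by rewrite eq_sym -subr_eq0 -natrB // natr_eq0; lia.
Qed.

(* All the forms are taken in the pencil x + i y. *)
Lemma power_rank e :
  (forall c, (c <= e)%N -> (\sum_i (e.+1 - a i - c) <= e.+1 - c)%N) ->
  exists v : 'I_(s.+1 * 3) -> K,
    (#|{: tri e.+1}| <= \rank (spanmx a
         (fun i => param_form v (widen_ord (leqnSn s) i) ^+ a i) e.+1) +
       \sum_(c < e.+1) (e.+1 - c - \sum_i (e.+1 - a i - c)))%N.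
Proof.
move=> le_e.
have [v vE] := param_form_surj (fun r : 'I_s.+1 => vec3 1 r%:R 0 : 'I_3 -> K).
exists v; set M := spanmx _ _ _.
(* For the exponent [c] of z, [pol] has degree at most [e - c]; [N c] is the number of roots still
   missing, imposed at the fresh points [s], [s + 1], and so on. *)
pose N (c : nat) := (e.+1 - c - \sum_i (e.+1 - a i - c))%N.
pose T := {c : 'I_e.+1 & 'I_(N c)}.
have cardT : #|{: T}| = (\sum_(c < e.+1) N c)%N.
  by rewrite card_tagged sumnE big_map big_enum /=; apply: eq_bigr => c _; rewrite card_ord.
rewrite -cardT.
pose ev (t : T) := crd e.+1
  (('X_o0 + (s + tagged t)%:R *: 'X_o1) ^+ (e - tag t) * 'X_o2 ^+ tag t : {mpoly K[3]}).
pose Q : 'M[K]_(#|{: T}|, _) := \matrix_t ev (enum_val t).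
apply: (rank_of_kernel (Q := Q)) => w Mw Qw.
apply: crd_fun_eq0; apply: lam_tmon_eq0 => // c lt_ce.
have lam_i := crd_fun_span (fun i => param_form_homog _ _ _) Mw.
pose J := ('I_s + 'I_(N c))%type.
pose x (j : J) : K := match j with inl i => i%:R | inr i => (s + i)%:R end.
have x_inj : injective x.
  move=> [i|i] [j|j] /natr_inj /= eq_ij; have := ltn_ord i; have := ltn_ord j => *.
  - by congr inl; apply: val_inj.
  - by exfalso; lia.
  - by exfalso; lia.
  - by congr inr; apply: val_inj; apply: (@addnI s).
apply: (root_count x_inj
    (e := fun j : J => if j is inl i then (e.+1 - a i - c)%N else 1%N)) => [[i|i]|].
- have -> : (e.+1 - a i - c = (e - c).+1 - a i)%N by lia.
  apply: pol_dvd => h; rewrite -(lam_i i h) vE linform_vec3 /=.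
  by rewrite scale1r scale0r addr0.
- apply: pol_dvd1; pose t : T := Tagged (fun c : 'I_e.+1 => 'I_(N c)) (i : 'I_(N (Ordinal lt_ce))).
  have /colP/(_ 0) : row (enum_rank t) Q *m w = 0 by rewrite -row_mul Qw row0.
  by rewrite rowK enum_rankK [RHS]mxE.
- apply: leq_trans (size_pol _ _ _ _) _; rewrite big_sumType /= sum1_card card_ord.
  by have := le_e c lt_ce; rewrite /N /=; lia.
Qed.

(** The forms are z and [x + x_i y + tau_i z], with [tau] from [spread_points]. Adding [q] auxiliary
    simple points makes the root counts suffice, and each point costs one in rank. *)
Lemma power_cube_rank d q : (1 < d)%N ->
  (\sum_i (d.+1 - a i - 1) <= d.-1)%N ->
  (3 * d <= 3 * (\sum_i (d.+1 - a i - 1)) + #|[set i | d.+1 - a i == 1]| + q)%N ->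
  exists v : 'I_(s.+1 * 3) -> K,
    let rho := with_cube (widen_ord (leqnSn s)) ord_max in
    let b := with_cube a 3 in
    (#|{: tri d.+1}| <=
       \rank (spanmx b (fun i => param_form v (rho i) ^+ b i) d.+1) + q)%N.
Proof.
move=> d_gt1 le1 le2.
pose J := ('I_s + 'I_q)%type.
(* Exponent [d] at an auxiliary point means multiplicity one. *)
pose aJ (j : J) := if j is inl i then a i else d.
pose m (j : J) := (d.+1 - aJ j)%N.
pose x (j : J) : K := (enum_rank j)%:R.
have x_inj : injective x by move=> i j /natr_inj /val_inj /enum_rank_inj.
have sumJ : (\sum_j (m j - 1) = \sum_i (d.+1 - a i - 1))%N.
  by rewrite big_sumType /= [X in (_ + X)%N]big1 ?addn0 // => i _; rewrite /m /=; lia.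
have [|||tau [tau_le2 count0 count1 count2]] := @spread_points J m d.
- by lia.
- by rewrite sumJ.
- rewrite sumJ;apply: leq_trans le2 _; rewrite -addnA leq_add2l.
  rewrite -!pcard_sum big_sumType /=; apply: leq_add.
    by apply: leq_sum => i _; rewrite !inE.
  rewrite -[X in (X <= _)%N]card_ord -sum1_card; apply: leq_sum => i _.
  by rewrite inE /m /= subSnn.
pose row3 j := vec3 1 (x j) (tau j)%:R : 'I_3 -> K.
(* [insub] fails only on the last row, which carries [L = z]. *)
have [v vE] := param_form_surj (fun r : 'I_s.+1 =>
  if insub (r : nat) is Some i then row3 (inl i) else vec3 0 0 1 : 'I_3 -> K).
exists v => rho b; set M := spanmx _ _ _.
pose Q := spanmx (fun _ : 'I_q => d) (fun j => linform (row3 (inr j)) ^+ d) d.+1.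
have cardQ : #|{: rowidx (fun _ : 'I_q => d) d.+1}| = q.
  by rewrite card_rowidx sum_nat_const card_ord subSnn binn muln1.
rewrite -[X in (_ <= _ + X)%N]cardQ.
apply: (rank_of_kernel (Q := Q)) => w Mw Qw.
apply: crd_fun_eq0; apply: lam_tmon_eq0 => // c lt_cd.
have lamM := crd_fun_span (fun i => param_form_homog _ _ _) Mw.
have lamQ := crd_fun_span (fun j => lform_homog _ _) Qw.
have row3E j : linform (row3 j) = 'X_o0 + x j *: 'X_o1 + (tau j)%:R *: 'X_o2.
  by rewrite linform_vec3 scale1r.
have d2 : d = d.-2.+2 by lia.
have lamZ3 h : crd_fun w (h * 'X_o2 ^+ 3) = 0.
  have := lamM None h; rewrite vE /= insubF ?ltnn // linform_vec3.
  by rewrite !scale0r !add0r scale1r.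
move: c lt_cd; rewrite /= => c lt_cd.
have := @pol_vanish K (crd_fun w) char0 d.-2.
rewrite -d2 => /(_ lamZ3 J x tau aJ x_inj _ tau_le2 count0 count1 count2 c lt_cd).
apply=> -[i|i] h; rewrite -row3E; last exact: (lamQ i h).
have := lamM (Some i) h; rewrite vE /=.
by rewrite (insubT (fun k => k < s)%N (ltn_ord i)) /= (_ : Sub _ _ = i) //; apply: val_inj.
Qed.

End SpecialPosition.

(** * Dimension count *)

Lemma sum_subn_ord n k : (k <= n)%N -> (\sum_(c < n) (k - c) = 'C(k.+1, 2))%N.
Proof.
move=> le_kn; rewrite -(subnKC le_kn) big_split_ord /= [X in (_ + X)%N]big1 ?addn0.
  rewrite -card_tri card_tagged sumnE big_map big_enum /=.
  by apply: eq_bigr => c _; rewrite card_ord.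
by move=> i _; lia.
Qed.

(** For [m >= 2] the triangular numbers differ by [3 (m - 1)]; truncation makes [m = 1] exceptional,
    which is how simple points enter [q]. *)
Lemma bin2_sub3 m : 'C(m.+1, 2) = ('C((m - 3).+1, 2) + 3 * (m - 1) + (m == 1))%N.
Proof. by case: m => [|[|[|m]]] //; rewrite !subSS !subn0 !binS !bin1 !bin0 /=; lia. Qed.

(* The left-hand side is dim I_(e+3) + q + codim I_e when I has the expected
   dimension in both degrees; q is the expected corank of L^3. *)
Lemma dimension_count s (a : 'I_s -> nat) e q :
  (forall c, (c <= e)%N -> (\sum_i (e.+1 - a i - c) <= e.+1 - c)%N) ->
  (3 * (\sum_i (e.+4 - a i - 1)) + #|[set i | e.+4 - a i == 1]| + q = 3 * e.+3)%N ->
  (#|{: rowidx a e.+4}| + q +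
     \sum_(c < e.+1) (e.+1 - c - \sum_i (e.+1 - a i - c)) = #|{: tri e.+4}|)%N.
Proof.
move=> le_e q_eq; rewrite card_rowidx card_tri.
have split_rows : (\sum_i 'C((e.+4 - a i).+1, 2) = \sum_i 'C((e.+1 - a i).+1, 2) +
    3 * (\sum_i (e.+4 - a i - 1)) + #|[set i | e.+4 - a i == 1]|)%N.
  rewrite -pcard_sum big_distrr -!big_split /=; apply: eq_bigr => i _.
  by rewrite inE bin2_sub3; congr ('C(_.+1, 2) + _ + _)%N; lia.
(* Both sums are sliced by the exponent [c]; [le_e] makes each subtraction exact. *)
have count_e : (\sum_(c < e.+1) (e.+1 - c - \sum_i (e.+1 - a i - c)) +
    \sum_i 'C((e.+1 - a i).+1, 2) = 'C(e.+2, 2))%N.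
  under [X in (_ + X)%N]eq_bigr => i _ do
    rewrite -(@sum_subn_ord e.+1 (e.+1 - a i)) ?leq_subr //.
  rewrite exchange_big -big_split -(@sum_subn_ord e.+1 e.+1) //=.
  by apply: eq_bigr => c _; rewrite subnK // le_e // -ltnS.
have bin_e : 'C(e.+4.+1, 2) = ('C(e.+2, 2) + 3 * e.+3)%N.
  by rewrite bin2_sub3 !subSS !subn0 addn0.
lia.
Qed.

(** * Combining the two special positions *)

Theorem theorem6p2 (K : fieldType) (s : nat) (a : 'I_s -> nat) (p : nat) :
  [pchar K] =i pred0 ->
  (3 <= s)%N ->
  (forall i, (0 < a i)%N) ->
  pcond a p -> (forall j : nat, pcond a j -> (j <= p)%N) ->
  (2 <= p)%N ->
  exists F : {mpoly K[s.+1 * 3]}, F != 0 /\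
    forall v : 'I_(s.+1 * 3) -> K, F.@[v] != 0 ->
      mulL3_maximal_rank
        (fun i : 'I_s => param_form v (widen_ord (leqnSn s) i) ^+ a i)
        (param_form v ord_max) (p - 2).
Proof.
move=> char0 _ _ pcond_p _; case: p pcond_p => [|[|e]] // pcond_p _.
rewrite subn2 /=.
(* With [p = e + 2] and [d = e + 3], [e.+4 - a i] is [m_i], and [pcond a p] bounds the sum of the
   [m_i - 1] by [d - 1]. *)
have sum_le : (\sum_i (e.+4 - a i - 1) <= e.+2)%N.
  apply: leq_trans pcond_p; rewrite [X in (_ <= X)%N]big_mkcond /=.
  by apply: leq_sum => i _; case: (leqP (a i) e.+2); lia.
(* A positive term lies exactly [2 + c] below the corresponding term of [sum_le], and no other term
   is larger than its counterpart. *)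
have le_e c : (c <= e)%N -> (\sum_i (e.+1 - a i - c) <= e.+1 - c)%N.
  move=> le_ce; case: (pickP (fun i => 0 < e.+1 - a i - c)%N) => [i i_gt0|none].
    have : (\sum_i (e.+1 - a i - c) + (2 + c) <= \sum_i (e.+4 - a i - 1))%N.
      rewrite (bigD1 i) //= [X in (_ <= X)%N](bigD1 i) //= addnAC.
      apply: leq_add; first by lia.
      by apply: leq_sum => j _; lia.
    by lia.
  by rewrite big1 // => i _; have := none i; lia.
pose l := #|[set i | e.+4 - a i == 1]%N|.
pose q := (3 * e.+3 - 3 * (\sum_i (e.+4 - a i - 1)) - l)%N.
have [v1 rk1] := power_rank char0 le_e.
have [|||v3 rk3] := @power_cube_rank K s a char0 e.+3 q.
- by [].
- exact: sum_le.
- by rewrite -/l; lia.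
have [F1 [F1v1 F1_rk]] := generic_span_rank a (widen_ord (leqnSn s)) e.+1 v1.
have [F3 [F3v3 F3_rk]] := generic_span_rank
  (with_cube a 3) (with_cube (widen_ord (leqnSn s)) ord_max) e.+4 v3.
(* [v1] and [v3] may differ: each factor is nonzero at its own point, and a product of nonzero
   polynomials is nonzero. *)
exists (F1 * F3); split.
  by rewrite mulf_neq0 //; [apply: contraNneq F1v1 | apply: contraNneq F3v3] => ->;
    rewrite meval0.
move=> v; rewrite mevalM mulf_eq0 negb_or => /andP[/F1_rk {}rk1v /F3_rk {}rk3v].
have rk1' := leq_trans rk1 (leq_add rk1v (leqnn _)).
have := leq_trans rk3 (leq_add rk3v (leqnn _)); set M3 := spanmx _ _ _.
have -> : M3 = spanmx (with_cube a 3)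
    (with_cube (fun i => param_form v (widen_ord (leqnSn s) i) ^+ a i)
               (param_form v ord_max ^+ 3)) e.+4.
  by apply/matrixP => r j; rewrite !mxE; case: (enum_val r) => [[i|] u].
move=> rk3'; have hg i := param_form_homog v (widen_ord (leqnSn s) i) (a i).
have hL := param_form_homog v ord_max 3.
(* When [q > 0] its truncated subtraction is exact, giving the equality that [dimension_count]
   requires. *)
case: (posnP q) => [q0 | q_gt0]; [right | left].
  by move: rk3'; rewrite q0 addn0; apply: mulL3_surjective_of_rank.
apply: (mulL3_injective_of_rank hg hL rk1' rk3').
by rewrite dimension_count // -/l; lia.
Qed.
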